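(* Let $n\ge4$ and $k\ge1$ be integers. Then \[ \gamma_{[k]R}(C_8\Box P_n)\le 8(n-2)\left\lceil\frac{k+5}{5}\right\rceil+16\left\lceil\frac{k+3-\left\lceil\frac{k+5}{5}\right\rceil}{3}\right\rceil-2\left(n-\left\lfloor\frac n3\right\rfloor\right). \]
   Context: For a graph $G$ and $v\in V(G)$, $N(v)$ is the open neighborhood and $N[v]=N(v)\cup\{v\}$. For an integer $k\ge1$, a function $f:V(G)\to\{0,1,\dots,k+1\}$ is a $[k]$-Roman dominating function if for every vertex $v$ with $f(v)<k$ we have $\sum_{u\in N[v]}f(u)\ge k+|\{u\in N(v): f(u)>0\}|$. The weight of $f$ is $\sum_{v}f(v)$, and $\gamma_{[k]R}(G)$ is the minimum weight of a $[k]$-Roman dominating function on $G$. $C_m\Box P_n$ is the Cartesian product of the cycle $C_m$ (vertices $0,\dots,m-1$ mod $m$) and the path $P_n$ (vertices $0,\dots,n-1$): $(i,j)\sim(i',j')$ iff ($i=i'$ and $|j-j'|=1$) or ($j=j'$ and $i'\equiv i\pm1 \pmod m$). *)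

(* Defs.v *)
From mathcomp Require Import all_boot all_order all_algebra.

Set Implicit Arguments.
Unset Strict Implicit.
Unset Printing Implicit Defensive.

(* A finite simple graph is given by its vertex type and its adjacency relation,
   which is to be symmetric and irreflexive. *)

Section RomanDomination.

Variables (V : finType) (e : rel V) (k : nat).

Definition open_nbhd (v : V) : {set V} := [set u | e v u].

Definition closed_nbhd (v : V) : {set V} := v |: open_nbhd v.

(* The values of f lie in 'I_k.+2 = {0, ..., k + 1}. *)
Definition is_kRDF (f : {ffun V -> 'I_k.+2}) : bool :=
  [forall v, (f v < k) ==>
     (k + #|[set u in open_nbhd v | 0 < f u]| <= \sum_(u in closed_nbhd v) f u)].

Definition weight (f : {ffun V -> 'I_k.+2}) : nat := \sum_v f v.

Definition const_kRDF : {ffun V -> 'I_k.+2} := [ffun => ord_max].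

Lemma const_kRDFP : is_kRDF const_kRDF.
Proof. by apply/forallP => v; rewrite ffunE /= ltnNge leqnSn. Qed.

(* const_kRDF only witnesses that the minimum is over a nonempty set. *)
Definition kRoman_number : nat :=
  weight [arg min_(f < const_kRDF | is_kRDF f) weight f].

Lemma kRoman_number_attained :
  exists2 f, is_kRDF f & weight f = kRoman_number.
Proof.
rewrite /kRoman_number; case: arg_minnP => [|f fP _]; first exact: const_kRDFP.
by exists f.
Qed.

Lemma kRoman_number_le f : is_kRDF f -> kRoman_number <= weight f.
Proof.
rewrite /kRoman_number; case: arg_minnP => [|g _ gmin]; first exact: const_kRDFP.
exact: gmin.
Qed.

End RomanDomination.

(* The clause i = j + 1 [mod m] encodes j = i - 1 [mod m] without truncated
   subtraction; this is the cycle C_m for m >= 3. *)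
Definition cycle_graph (m : nat) : rel 'I_m :=
  fun i j => (j == i.+1 %[mod m]) || (i == j.+1 %[mod m]).

Definition path_graph (n : nat) : rel 'I_n :=
  fun i j => (j == i.+1 :> nat) || (i == j.+1 :> nat).

Definition cart_graph (V W : finType) (e : rel V) (e' : rel W) : rel (V * W) :=
  fun x y => ((x.1 == y.1) && e' x.2 y.2) || ((x.2 == y.2) && e x.1 y.1).

Lemma cycle_graph_sym m : symmetric (@cycle_graph m).
Proof. by move=> i j; rewrite /cycle_graph orbC. Qed.

Lemma cycle_graph_irr m : 1 < m -> irreflexive (@cycle_graph m).
Proof.
move=> m_gt1 i; rewrite /cycle_graph orbb -addn1 -{1}[val i]addn0 eqn_modDl.
by rewrite mod0n modn_small.
Qed.

Lemma path_graph_sym n : symmetric (@path_graph n).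
Proof. by move=> i j; rewrite /path_graph orbC. Qed.

Lemma path_graph_irr n : irreflexive (@path_graph n).
Proof. by move=> i; rewrite /path_graph orbb ltn_eqF. Qed.

Lemma cart_graph_sym (V W : finType) (e : rel V) (e' : rel W) :
  symmetric e -> symmetric e' -> symmetric (cart_graph e e').
Proof.
move=> se se' x y.
by rewrite /cart_graph se se' (eq_sym x.1) (eq_sym x.2).
Qed.

Lemma cart_graph_irr (V W : finType) (e : rel V) (e' : rel W) :
  irreflexive e -> irreflexive e' -> irreflexive (cart_graph e e').
Proof. by move=> ie ie' x; rewrite /cart_graph ie ie' !andbF. Qed.

(* Main.v *)
(** A labelling f is a [k]-Roman dominating function as soon as, for every vertex v,
    f v >= k or f v plus the sum of (f u - 1)^+ over the neighbours u of v is at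
    least k. With a and b the two ceilings, the labelling with value b on the two
    end cycles and a elsewhere has this property, with slack at least 1 at the
    vertices of degree 4 and an extra slack b - a next to the end cycles. One
    saves on it by subtracting 1 at two antipodal vertices of two consecutive
    cycles out of three. At the ends, where the end cycles may be tight, raising
    one value by 1 pays for lowering three values in the next cycle, provided
    that a < b. This inequality fails only for some k <= 21, for which the
    labelling with value k + 1 on a dominating set of size 2n is light enough.
    The lengths n = 4 and n = 5 need labellings of their own. *)

Require Import Defs.
From mathcomp Require Import all_boot all_order all_algebra.
From mathcomp Require Import zify lra.
Import Order.TTheory GRing.Theory Num.Theory.

Set Implicit Arguments.
Unset Strict Implicit.
Unset Printing Implicit Defensive.

Local Open Scope nat_scope.

(** * Local criterion and sums over neighbourhoods *)

(** Writing [f u] as [(f u).-1 + (0 < f u)] cancels the count of positive neighbours. *)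
Lemma is_kRDF_pred (V : finType) (e : rel V) (k : nat)
    (f : {ffun V -> 'I_k.+2}) :
  irreflexive e ->
  (forall v, (k <= f v) || (k <= f v + \sum_(u | e v u) (f u).-1)) ->
  is_kRDF e f.
Proof.
move=> irr_e fP; apply/forallP => v; apply/implyP => fv_lt.
have {fP} := fP v; rewrite leqNgt fv_lt /= => k_le.
rewrite /closed_nbhd /open_nbhd big_setU1 ?inE ?irr_e //=.
rewrite -sum1_card (eq_bigl (fun u => e v u && (0 < f u))) => [|u]; last first.
  by rewrite !inE.
rewrite [X in _ <= _ + X](eq_bigl (e v)) => [|u]; last by rewrite inE.
rewrite big_mkcondr [X in _ <= _ + X](eq_bigr (fun u => (f u).-1 + (0 < f u))).
  by rewrite big_split /= addnA leq_add2r.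
by move=> u _; case: (f u : nat) => [|x] //=; rewrite addn1.
Qed.

(** Irreflexivity of [e] keeps the two kinds of neighbours disjoint. *)
Lemma sum_cart_nbhd (V W : finType) (e : rel V) (e' : rel W)
    (F : V -> W -> nat) (v : V) (w : W) : irreflexive e ->
  \sum_(u | cart_graph e e' (v, w) u) F u.1 u.2 =
  \sum_(j | e' w j) F v j + \sum_(i | e v i) F i w.
Proof.
move=> irr_e; rewrite (bigID (fun u => v == u.1)) /=; congr (_ + _).
  rewrite (eq_bigl (fun u => (v == u.1) && e' w u.2)).
    by rewrite -(pair_big_dep _ (fun _ => e' w)) (big_pred1 v).
  case=> i j; rewrite /cart_graph /= andbC.
  by case: eqP => //= <-; rewrite irr_e andbF orbF.
rewrite (eq_bigl (fun u => e v u.1 && (w == u.2))).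
  rewrite -(pair_big_dep _ (fun _ => eq_op w)).
  by apply: eq_bigr => i _; rewrite (big_pred1 w).
case=> i j; rewrite /cart_graph /= andbC (andbC (w == j)).
by case: (v =P i) => [<-|_]; rewrite ?irr_e.
Qed.

Lemma sum_cycle8_nbhd (F : nat -> nat) (c : 'I_8) :
  \sum_(i | cycle_graph c i) F i = F (c.+1 %% 8) + F ((c + 7) %% 8).
Proof.
rewrite big_mkcond !big_ord_recl big_ord0 /cycle_graph.
by case: c => [[|[|[|[|[|[|[|[|c]]]]]]]] c_lt] //=;
  rewrite /bump /= ?(addn0, add0n) // addnC.
Qed.

(** [F n = 0] absorbs the missing right neighbour of the last vertex. *)
Lemma sum_path_nbhd (n : nat) (F : nat -> nat) (j : 'I_n) : F n = 0 ->
  \sum_(i | path_graph j i) F i = (if j : nat is j'.+1 then F j' else 0) + F j.+1.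
Proof.
move=> Fn0; rewrite (bigID (fun i : 'I_n => i == j.+1 :> nat)) /= addnC; congr (_ + _).
  case: j => [[|j]] /= j_lt.
    rewrite big_pred0 // => i; rewrite /path_graph /= (eq_sym 0).
    by case: (i =P 1 :> nat) => [->|].
  rewrite (big_pred1 (Ordinal (ltnW j_lt))) // => i.
  rewrite /path_graph /= -val_eqE /= eqSS (eq_sym j) /=; lia.
have [j_lt|n_le] := ltnP j.+1 n.
  rewrite (big_pred1 (Ordinal j_lt)) // => i.
  by rewrite /path_graph /= -val_eqE /=; lia.
have -> : j.+1 = n by apply/eqP; rewrite eqn_leq n_le ltn_ord.
rewrite Fn0 big1 // => i /andP[_ /eqP i_eq]; have := ltn_ord i; lia.
Qed.

(* A labelling of C_8 x P_n is the list of its n rows, each of length 8; p and q are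
   the rows next to r, and they are empty beyond the ends of the path, so that
   the entries read there are 0. *)
Definition row_dominated (k : nat) (p r q : seq nat) : bool :=
  all (fun c => (k <= nth 0 r c) ||
    (k <= nth 0 r c + ((nth 0 p c).-1 + (nth 0 q c).-1 +
       ((nth 0 r (c.+1 %% 8)).-1 + (nth 0 r ((c + 7) %% 8)).-1)))) (iota 0 8).

Ltac row_domination :=
  by rewrite /= /row_dominated /=; do ?(apply/andP; split); lia.

Fixpoint rows_dominated (k : nat) (p : seq nat) (s : seq (seq nat)) : bool :=
  if s is r :: s' then row_dominated k p r (head [::] s') && rows_dominated k r s'
  else true.

Lemma rows_dominated_nth k p s i : rows_dominated k p s -> i < size s ->
  row_dominated k (if i is i'.+1 then nth [::] s i' else p) (nth [::] s i)
    (nth [::] s i.+1).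
Proof.
elim: s p i => //= r s IHs p [|i] /andP[r_dom s_dom] i_lt.
  by move: r_dom; rewrite -nth0.
by have := IHs r i s_dom i_lt; case: (i).
Qed.

Definition rows_wf (k : nat) (s : seq (seq nat)) : bool :=
  all (fun r => (size r == 8) && all (fun x => x <= k.+1) r) s.

Lemma kRoman_number_le_rows k n s : size s = n -> rows_wf k s ->
  rows_dominated k [::] s ->
  kRoman_number (cart_graph (@cycle_graph 8) (@path_graph n)) k
    <= sumn (map sumn s).
Proof.
move=> size_s /allP s_wf s_dom.
pose g i c := nth 0 (nth [::] s i) c.
pose f := [ffun x : 'I_8 * 'I_n => inord (g x.2 x.1) : 'I_k.+2].
have fE x : f x = g x.2 x.1 :> nat.
  rewrite ffunE inordK // ltnS /g.
  have /s_wf/andP[/eqP size_r /allP r_le] : nth [::] s x.2 \in s.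
    by rewrite mem_nth // size_s.
  by rewrite r_le // mem_nth // size_r.
apply: leq_trans (@kRoman_number_le _ _ _ f _) _.
  apply: is_kRDF_pred => [|[c j]].
    by apply: cart_graph_irr; [exact: cycle_graph_irr|exact: path_graph_irr].
  rewrite fE (eq_bigr (fun u : 'I_8 * 'I_n => (g u.2 u.1).-1)); last first.
    by move=> u _; rewrite fE.
  rewrite (sum_cart_nbhd _ (fun (i : 'I_8) (i' : 'I_n) => (g i' i).-1)); last first.
    exact: cycle_graph_irr.
  rewrite (@sum_path_nbhd _ (fun i => (g i c).-1)); last first.
    by rewrite /g (nth_default [::]) ?size_s // nth_nil.
  rewrite (sum_cycle8_nbhd (fun i => (g j i).-1)) /=.
  have j_lt : j < size s by rewrite size_s.
  have /allP/(_ c) := rows_dominated_nth s_dom j_lt.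
  rewrite mem_iota => /(_ (ltn_ord c)).
  by case: (j : nat) => [|j']; rewrite /= ?nth_nil.
rewrite /weight (eq_bigr (fun x : 'I_8 * 'I_n => g x.2 x.1)) => [|x _]; last by rewrite fE.
rewrite -(pair_bigA _ (fun (i : 'I_8) (j : 'I_n) => g j i)) exchange_big /=.
rewrite sumnE big_map (big_nth [::]) size_s big_mkord.
apply: leq_sum => j _; rewrite sumnE (big_nth 0).
have /s_wf/andP[/eqP -> _] : nth [::] s j \in s by rewrite mem_nth // size_s.
by rewrite big_mkord.
Qed.

(** * Explicit labellings *)

Fixpoint alternate (n : nat) (x y : seq nat) : seq (seq nat) :=
  if n is n'.+1 then x :: alternate n' y x else [::].

(** Each zero of [A] lies beside a [k.+1] of its own row or faces one in an adjacent row [B], and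
    conversely. *)
Lemma kRoman_number_le_domination k n : 2 <= n ->
  kRoman_number (cart_graph (@cycle_graph 8) (@path_graph n)) k <= 2 * n * k.+1.
Proof.
move=> n_ge2.
pose A := [:: k.+1; 0; 0; 0; k.+1; 0; 0; 0].
pose B := [:: 0; 0; k.+1; 0; 0; 0; k.+1; 0].
have size_alt x y : size (alternate n x y) = n.
  by elim: n x y {n_ge2} => //= n IHn x y; rewrite IHn.
have domA p q : (p == B) || (q == B) -> row_dominated k p A q.
  by case/orP => /eqP->; row_domination.
have domB p q : (p == A) || (q == A) -> row_dominated k p B q.
  by case/orP => /eqP->; row_domination.
have alt_dom m : rows_dominated k B (alternate m A B) &&
    rows_dominated k A (alternate m B A).
  by elim: m => //= m /andP[-> ->]; rewrite domA ?domB ?eqxx.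
apply: leq_trans (@kRoman_number_le_rows k n (alternate n A B) _ _ _) _ => //.
- have : all (mem [:: A; B]) (alternate n A B).
    suff: all (mem [:: A; B]) (alternate n A B) && all (mem [:: A; B]) (alternate n B A).
      by case/andP.
    elim: n {n_ge2 size_alt} => //= n /andP[-> ->].
    by rewrite !inE !eqxx orbT.
  apply: sub_all => r; rewrite !inE => /orP[] /eqP->; rewrite /= !ltnSn //.
- case: n n_ge2 {size_alt} => [|[|n]] // _.
  have /andP[_ dom] := alt_dom n.+1.
  by rewrite [alternate _ _ _]/= -/(alternate n.+1 B A) /= domA ?eqxx ?orbT //; exact: dom.
suff -> : forall x y, sumn x = 2 * k.+1 -> sumn y = 2 * k.+1 ->
    sumn (map sumn (alternate n x y)) = 2 * n * k.+1 by rewrite // /= ; lia.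
elim: n {n_ge2 size_alt} => [|n IHn] x y sx sy /=; first by rewrite muln0.
by rewrite IHn // sx; lia.
Qed.

Lemma kRoman_number_le_long k n a b : 6 <= n -> 1 < a ->
  k + 5 <= 5 * a -> k + 3 <= 3 * b + a -> a < b -> b <= k ->
  kRoman_number (cart_graph (@cycle_graph 8) (@path_graph n)) k
    + 2 * (n - n %/ 3) <= 8 * (n - 2) * a + 16 * b.
Proof.
move=> n_ge6 a_gt1 ha hb ab bk.
pose dbl (r : seq nat) := r ++ r.
pose A := dbl [:: a.-1; a; a; a].
pose B := dbl [:: a; a; a.-1; a].
pose Z := dbl [:: a; a; a; a].
(* [b.+1] faces the lowered entry of [E1] whose two row neighbours are lowered as well. The entry
   [a] left in [E1] is in a column lowered in [A], as a vertex of [Z] tolerates only one lowered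
   neighbour. The primed rows are shifted by two columns to fit [B]. *)
pose E0 := dbl [:: b; b; b.+1; b].
pose E1 := dbl [:: a; a.-1; a.-1; a.-1].
pose E0' := dbl [:: b.+1; b; b; b].
pose E1' := dbl [:: a.-1; a.-1; a; a.-1].
pose mid (s : seq (seq nat)) := [:: A, B, Z & s].
(* Tails for [n %% 3 = t]: together with the initial rows they save [8 + 2 * t], and each period
   [mid] saves 4. *)
pose T t := nth [::] [:: [:: Z; E1'; E0']; [:: A; Z; E1; E0]; [:: A; B; Z; E1'; E0']] t.
have [q [t [t_lt nE qE]]] : exists q t, [/\ t < 3, n = 6 + 3 * q + t & n %/ 3 = q + 2].
  by exists (n %/ 3 - 2), (n %% 3); split; lia.
pose s := [:: E0, E1, Z & iter q mid (T t)].
have size_T u : u < 3 -> size (T u) = 3 + u by case: u => [|[|[|u]]].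
have sum_T u : u < 3 -> sumn (map sumn (T u)) + 4 + 2 * u = 8 * (2 + u) * a + 8 * b.
  by case: u => [|[|[|u]]] //= _; lia.
pose L := [:: A; B; Z; E0; E1; E0'; E1'].
have wf_L r : r \in L -> (size r == 8) && all (fun x => x <= k.+1) r.
  by rewrite !inE; do ![case/predU1P => [->|]]; last move/eqP->; rewrite /=; lia.
have all_T u : u < 3 -> all (mem L) (T u).
  by case: u => [|[|[|u]]] // _; rewrite /= !inE !eqxx ?orbT.
have dom_T u : u < 3 -> rows_dominated k Z (T u) && (head [::] (T u) \in [:: A; Z]).
  case: u => [|[|[|u]]] //= _; rewrite !inE !eqxx ?orbT andbT;
    row_domination.
have size_s : size s = n.
  have -> : size s = 3 + (3 * q + size (T t)).
    by rewrite /s /=; elim: (q) => //= m; lia.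
  by rewrite size_T // [RHS]nE; lia.
have s_wf : rows_wf k s.
  apply: (sub_all wf_L); rewrite /s /= !inE !eqxx ?orbT /=.
  by elim: (q) => [|m] /=; [exact: all_T|rewrite !inE !eqxx ?orbT].
have s_dom : rows_dominated k [::] s.
  have rest_dom : rows_dominated k Z (iter q mid (T t)) &&
      (head [::] (iter q mid (T t)) \in [:: A; Z]).
    elim: (q) => [|m /andP[m_dom]] /=; first exact: dom_T.
    rewrite !inE => /orP[] /eqP head_m; rewrite m_dom head_m eqxx !andbT;
      row_domination.
  case/andP: rest_dom => rest_dom; rewrite /s /= rest_dom andbT !inE.
  by case/orP => /eqP->; row_domination.
have sum_s : sumn (map sumn s) + 2 * (n - n %/ 3) = 8 * (n - 2) * a + 16 * b.
  have -> : sumn (map sumn s) =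
      q * (24 * a - 4) + 16 * a + 8 * b - 4 + sumn (map sumn (T t)).
    rewrite /s /=; elim: (q) => [|m IHm] /=; first lia.
    by rewrite mulSn; lia.
  by have := sum_T t t_lt; rewrite qE nE; nia.
by rewrite -sum_s leq_add2r; exact: kRoman_number_le_rows.
Qed.

(** Two lowered cycles are now adjacent, so [f v] plus the reduced values around [v] drops to
    [4 * a + b - 7] at some inner vertices. *)
Lemma kRoman_number_le_4 k a b : 0 < a -> k + 3 <= 3 * b + a ->
  k + 7 <= 4 * a + b -> a <= b -> b <= k ->
  kRoman_number (cart_graph (@cycle_graph 8) (@path_graph 4)) k + 8
    <= 16 * a + 16 * b.
Proof.
move=> a_gt0 hb hab ab bk.
pose E0 := [:: b; b.+1; b; b; b; b.+1; b; b].
pose E1 := [:: a.-1; a.-1; a.-1; a; a.-1; a.-1; a.-1; a].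
suff : kRoman_number (cart_graph (@cycle_graph 8) (@path_graph 4)) k <=
    sumn (map sumn [:: E0; E1; E1; E0]) by rewrite /=; lia.
apply: kRoman_number_le_rows => //; first by rewrite /=; lia.
row_domination.
Qed.

(** If [a + 2 <= b], the cycles next to the ends are lowered further and the middle one is raised to
    [a.+1], which works even for [5 * a = k + 5]. Otherwise each middle vertex has two neighbours
    lowered by 1, which uses [k + 6 <= 5 * a]. *)
Lemma kRoman_number_le_5 k a b : 2 < a -> k + 3 <= 3 * b + a ->
  k + 5 <= 5 * a -> a + 2 <= b \/ a < b /\ k + 6 <= 5 * a -> b <= k ->
  kRoman_number (cart_graph (@cycle_graph 8) (@path_graph 5)) k + 8
    <= 24 * a + 16 * b.
Proof.
move=> a_gt2 hb ha hab bk.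
pose E0 := [:: b.+1; b.+1; b; b; b.+1; b.+1; b; b].
have [ab2|ab1] := leqP (a + 2) b.
  pose E1 := [:: a - 2; a - 2; a - 1; a - 1; a - 2; a - 2; a - 1; a - 1].
  suff : kRoman_number (cart_graph (@cycle_graph 8) (@path_graph 5)) k <=
      sumn (map sumn [:: E0; E1; nseq 8 a.+1; E1; E0]) by rewrite /=; lia.
  apply: kRoman_number_le_rows => //; first by rewrite /=; lia.
  row_domination.
suff : kRoman_number (cart_graph (@cycle_graph 8) (@path_graph 5)) k <=
    sumn (map sumn [:: E0; nseq 8 a.-1; nseq 8 a; nseq 8 a.-1; E0]) by rewrite /=; lia.
apply: kRoman_number_le_rows => //; first by rewrite /=; lia.
row_domination.
Qed.

(* The bound to reach is 208, but by linear programming duality every positive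
   labelling with all values < 20 has weight at least 209, and value 21 on a
   dominating set of size 10 gives 210. This labelling was found by a computer search. *)
Lemma kRoman_number_20_5_le :
  kRoman_number (cart_graph (@cycle_graph 8) (@path_graph 5)) 20 <= 204.
Proof.
exact: (@kRoman_number_le_rows 20 5
  [:: [:: 21; 0; 0; 0; 21; 0; 0; 0];
      [:: 0; 0; 21; 0; 0; 0; 21; 0];
      [:: 11; 0; 0; 10; 11; 0; 0; 0];
      [:: 10; 11; 0; 0; 0; 11; 0; 11];
      [:: 0; 0; 11; 12; 0; 10; 0; 12]]).
Qed.

(** * Choice of the labelling and passage to ceilings *)

(** The double inequalities characterize [a] and [b] as the two ceilings. *)
Lemma kRoman_number_le_nat n k a b : 4 <= n -> 1 <= k ->
  k + 5 <= 5 * a <= k + 9 -> k + 3 <= 3 * b + a <= k + 5 ->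
  kRoman_number (cart_graph (@cycle_graph 8) (@path_graph n)) k
    + 2 * (n - n %/ 3) <= 8 * (n - 2) * a + 16 * b.
Proof.
move=> n_ge4 k_gt0 /andP[a_ge a_le] /andP[b_ge b_le].
(* [small] contains every [k] with [b <= a] and, for lengths 4 and 5, the multiples of 5 with
   [b < a + 2], except [k = 20] with [n = 5]; in all these cases [2 * n * k.+1] is small enough. *)
have [small|large] := boolP ((k <= 18) && (k != 15) || (k == 21) ||
    [&& n == 4, k <= 20 & 5 %| k] || (n == 5) && (k == 15)).
  have := @kRoman_number_le_domination k n (ltnW (ltnW n_ge4)).
  set g := kRoman_number _ _; move: g => g g_le.
  have k_in : k \in iota 1 21 by rewrite mem_iota; lia.
  move: k_in a_ge a_le b_ge b_le small g_le {k_gt0}; rewrite !inE.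
  do ![case/predU1P => [->|]]; last move/eqP->; move=> a_ge a_le b_ge b_le small;
    first [have -> : a = 2 by lia | have -> : a = 3 by lia | have -> : a = 4 by lia
          | have -> : a = 5 by lia | have -> : a = 6 by lia]; lia.
have ab : a < b by lia.
have bk : b <= k by lia.
have [n_ge6|n_lt6] := leqP 6 n; first by apply: kRoman_number_le_long; lia.
have [n4|n_neq4] := eqVneq n 4.
  rewrite n4 /= in large *; have := @kRoman_number_le_4 k a b; lia.
have n5 : n = 5 by lia.
rewrite n5 /= in large *.
have [k20|k_neq20] := eqVneq k 20.
  by have := kRoman_number_20_5_le; rewrite k20 in a_ge a_le b_ge b_le *; lia.
have := @kRoman_number_le_5 k a b; lia.
Qed.

Local Open Scope ring_scope.

Theorem theorem22 (n k : nat) (hn : (4 <= n)%N) (hk : (1 <= k)%N) :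
  (kRoman_number (cart_graph (@cycle_graph 8) (@path_graph n)) k)%:Z
    <= 8 * (n%:Z - 2) * Num.ceil ((k%:R + 5) / 5 : rat)
       + 16 * Num.ceil ((k%:R + 3 - (Num.ceil ((k%:R + 5) / 5 : rat))%:~R) / 3 : rat)
       - 2 * (n%:Z - (n %/ 3)%N%:Z).
Proof.
(* Clearing denominators turns each ceiling into integer inequalities that determine it. *)
have ceil_bounds (z : int) (d : nat) : (0 < d)%N ->
    (z <= d%:Z * Num.ceil (z%:~R / d%:R : rat) < z + d%:Z)%R.
  move=> d_gt0; have d0 : (0 < d%:R :> rat) by rewrite ltr0n.
  have /andP[lo hi] := @ceil_itv rat (z%:~R / d%:R).
  rewrite -(ltr_int rat) -(ler_int rat) !(intrD, intrM) /=.
  rewrite ler_pdivrMr // in hi.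
  rewrite ltr_pdivlMr // in lo.
  move: lo hi; rewrite intrD /=; set c := (Num.ceil _)%:~R; move=> lo hi.
  lra.
have := ceil_bounds (k%:Z + 5) 5%N isT.
rewrite intrD /=.
set A := Num.ceil _ => /andP[A_lo A_hi].
have := ceil_bounds (k%:Z + 3 - A) 3%N isT.
rewrite intrB intrD /=.
set B := Num.ceil _ => /andP[B_lo B_hi].
have AE : `|A|%N = A :> int by lia.
have BE : `|B|%N = B :> int by lia.
have a_bounds : (k + 5 <= 5 * `|A| <= k + 9)%N by lia.
have b_bounds : (k + 3 <= 3 * `|B| + `|A| <= k + 5)%N by lia.
have := kRoman_number_le_nat hn hk a_bounds b_bounds.
have -> : (n%:Z - 2)%R = (n - 2)%N by lia.
rewrite -{}AE -{}BE; move: (n - 2)%N => m; lia.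
Qed.
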